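(* Let $W^{(\lambda)}(x)=\frac{a^x}{x!}(I+A)^{x+\lambda}T^{(\lambda)}(I+A^* )^{x+\lambda}$, $x,\lambda\in\mathbb N_0$, and assume there exist real numbers $d^{(\lambda)}\ne0$ and $c^{(\lambda)}$ such that $$\frac{\delta_i^{(\lambda+1)}}{\delta_i^{(\lambda)}}-\frac{\delta_{i+1}^{(\lambda+1)}}{\delta_{i+1}^{(\lambda)}}=-\frac{d^{(\lambda)}a}{2},\quad i=1,\dots,N-1,$$ $$\frac{\mu_i^2}{\mu_{i-1}^2}\frac{\delta_{i-1}^{(\lambda+1)}}{\delta_i^{(\lambda)}}-\frac{\mu_{i+1}^2}{\mu_i^2}\frac{\delta_i^{(\lambda+1)}}{\delta_{i+1}^{(\lambda)}}=d^{(\lambda)}i+c^{(\lambda)},\quad i=1,\dots,N.$$ Let $$\Phi^{(\lambda)}(x)=W^{(\lambda)}(x)^{-1}W^{(\lambda+1)}(x),\qquad\Psi^{(\lambda)}(x)=W^{(\lambda)}(x)^{-1}(W^{(\lambda+1)}\cdot\Delta)(x-1).$$ Then $\Phi^{(\lambda)}$ is a matrix polynomial of degree at most two and $\Psi^{(\lambda)}$ is a matrix polynomial of degree at most one. Moreover $\Phi^{(\lambda)}(x)=x^2\mathcal K_2^{(\lambda)}+x\mathcal K_1^{(\lambda)}+\mathcal K_0^{(\lambda)}$ and $\Psi^{(\lambda)}(x)=x\mathcal J_1^{(\lambda)}+\mathcal J_0^{(\lambda)}$, where $$\mathcal K_2^{(\lambda)}=-\frac{d^{(\lambda)}}{2}A^*(A^*+I)^{-1},\qquad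 \mathcal K_1^{(\lambda)}=\frac{d^{(\lambda)}}2\bigl(2J-aA^*-(2\lambda+1)A^*(A^*+I)^{-1}\bigr)+c^{(\lambda)}I,$$ $$\mathcal K_0^{(\lambda)}=(A^*+I)^{-\lambda}(T^{(\lambda)})^{-1}(A+I)T^{(\lambda+1)}(A^*+I)^{\lambda+1},$$ $$\mathcal J_1^{(\lambda)}=\mathcal K_2^{(\lambda)}+\mathcal K_1^{(\lambda)}-\frac1a(A^*+I)^{-\lambda-1}(T^{(\lambda)})^{-1}T^{(\lambda+1)}(A^*+I)^{\lambda+1},\qquad\mathcal J_0^{(\lambda)}=\mathcal K_0^{(\lambda)}.$$
   Context: $N\ge1$, $a>0$, $\mathbb N_0=\{0,1,2,\dots\}$; $\mu_j>0$ ($1\le j\le N$) and $\delta_j^{(\lambda)}>0$ ($1\le j\le N$, $\lambda\in\mathbb N_0$). $A$ is the $N\times N$ matrix with $A_{j,k}=\mu_j/\mu_{j-1}$ if $j=k+1$ and $0$ otherwise; $T^{(\lambda)}=\mathrm{diag}(\delta_1^{(\lambda)},\dots,\delta_N^{(\lambda)})$; $J=\mathrm{diag}(1,\dots,N)$. $W^{(\lambda)}(x)=0$ for negative integers $x$; $(F\cdot\Delta)(x)=F(x+1)-F(x)$, and $\Phi^{(\lambda)},\Psi^{(\lambda)}$ are considered for $x\in\mathbb N_0$. In the second system of equations, the terms containing the undefined index $i-1=0$ (for $i=1$) or $i+1=N+1$ (for $i=N$) are read as $0$. *)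

(* Defs.v *)
From HB Require Import structures.
From mathcomp Require Import all_boot all_order all_algebra reals.
Set Implicit Arguments.
Unset Strict Implicit.
Unset Printing Implicit Defensive.
Import Order.TTheory GRing.Theory Num.Theory.
Local Open Scope ring_scope.

(* Scalar sequences such as mu_j and delta_j are functions of j : nat, of
   which only the values at 1 <= j <= N matter. The row (or column) of number
   j in {1, ..., N} of an N x N matrix has ordinal index j - 1. *)

Section Weight.

Variables (R : realType) (N : nat).

(* A_{j,k} = mu_j / mu_{j-1} if j = k + 1, with j = i.+1 and k = l.+1. *)
Definition subdiag_mx (mu : nat -> R) : 'M[R]_N :=
  \matrix_(i, l) (if i == l.+1 :> nat then mu i.+1 / mu i else 0).

Definition diag_seq_mx (t : nat -> R) : 'M[R]_N := diag_mx (\row_i t i.+1).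

Definition J_mx : 'M[R]_N := diag_seq_mx (fun j => j%:R).

(* The matrices are real, so the adjoint A^* is the transpose. *)
Definition W (a : R) (mu : nat -> R) (delta : nat -> nat -> R) (lambda : nat)
    (x : int) : 'M[R]_N :=
  match x with
  | Posz n =>
      (a ^+ n / n`!%:R) *:
        ((1%:M + subdiag_mx mu) ^+ (n + lambda) *m diag_seq_mx (delta lambda)
           *m (1%:M + (subdiag_mx mu)^T) ^+ (n + lambda))
  | Negz _ => 0
  end.

Definition fwd_diff (F : int -> 'M[R]_N) (x : int) : 'M[R]_N := F (x + 1) - F x.

(* [invmx] is the genuine inverse only on [unitmx]; for a, mu_j, delta_j > 0
   every matrix inverted below is invertible, as I + A is unipotent. *)
Definition Phi (a : R) (mu : nat -> R) (delta : nat -> nat -> R) (lambda x : nat)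
    : 'M[R]_N :=
  invmx (W a mu delta lambda x%:Z) *m W a mu delta lambda.+1 x%:Z.

Definition Psi (a : R) (mu : nat -> R) (delta : nat -> nat -> R) (lambda x : nat)
    : 'M[R]_N :=
  invmx (W a mu delta lambda x%:Z)
    *m fwd_diff (W a mu delta lambda.+1) (x%:Z - 1).

Definition matrix_poly_deg_le (k : nat) (F : nat -> 'M[R]_N) : Prop :=
  exists P : 'M[{poly R}]_N,
    (forall i j, (size (P i j) <= k.+1)%N) /\
    (forall x : nat, F x = map_mx (fun p : {poly R} => p.[x%:R]) P).

(* The two terms of the second system; those containing an index outside
   {1, ..., N} are read as 0. *)
Definition lower_term (mu : nat -> R) (delta : nat -> nat -> R) (lambda i : nat)
    : R :=
  if i == 1%N then 0
  else mu i ^+ 2 / mu i.-1 ^+ 2 * (delta lambda.+1 i.-1 / delta lambda i).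

Definition upper_term (mu : nat -> R) (delta : nat -> nat -> R) (lambda i : nat)
    : R :=
  if i == N then 0
  else mu i.+1 ^+ 2 / mu i ^+ 2 * (delta lambda.+1 i / delta lambda i.+1).

Definition K2_mx (mu : nat -> R) (d : R) : 'M[R]_N :=
  let As := (subdiag_mx mu)^T in
  - (d / 2) *: (As *m invmx (As + 1%:M)).

Definition K1_mx (a : R) (mu : nat -> R) (lambda : nat) (d c : R) : 'M[R]_N :=
  let As := (subdiag_mx mu)^T in
  (d / 2) *: (2 *: J_mx - a *: As
              - (2 * lambda + 1)%:R *: (As *m invmx (As + 1%:M)))
  + c *: 1%:M.

Definition K0_mx (mu : nat -> R) (delta : nat -> nat -> R) (lambda : nat)
    : 'M[R]_N :=
  let A := subdiag_mx mu in
  let As := A^T in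
  invmx (As + 1%:M) ^+ lambda *m invmx (diag_seq_mx (delta lambda))
    *m (A + 1%:M) *m diag_seq_mx (delta lambda.+1)
    *m (As + 1%:M) ^+ lambda.+1.

Definition J1_mx (a : R) (mu : nat -> R) (delta : nat -> nat -> R)
    (lambda : nat) (d c : R) : 'M[R]_N :=
  let As := (subdiag_mx mu)^T in
  K2_mx mu d + K1_mx a mu lambda d c
  - a^-1 *: (invmx (As + 1%:M) ^+ lambda.+1
               *m invmx (diag_seq_mx (delta lambda))
               *m diag_seq_mx (delta lambda.+1)
               *m (As + 1%:M) ^+ lambda.+1).

Definition J0_mx (mu : nat -> R) (delta : nat -> nat -> R) (lambda : nat)
    : 'M[R]_N := K0_mx mu delta lambda.

End Weight.

Arguments J_mx : clear implicits.
Arguments W {R} N.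
Arguments Phi {R} N.
Arguments Psi {R} N.
Arguments upper_term {R} N.
Arguments K2_mx {R} N.
Arguments K1_mx {R} N.
Arguments K0_mx {R} N.
Arguments J1_mx {R} N.
Arguments J0_mx {R} N.

(* Main.v *)
Require Import Defs.
From mathcomp Require Import all_boot all_order all_algebra reals.
From mathcomp Require Import ring.
Import Order.TTheory GRing.Theory Num.Theory.
Local Open Scope ring_scope.

(** Put X = A^*, U = I + X, S = X U^-1 = A^* (A^* + I)^-1 and write T, T' for
    the diagonal matrices of index lambda and lambda + 1. The left factors of
    the two weights cancel, so that, with n = x + lambda,

      Phi(x) = U^-n M U^n U,   where M = T^-1 (A + I) T' = D + B,
                               D = T^-1 T',  B = T^-1 A T'

    ([Phi_conj]), and Psi(x) = Phi(x) - (x / a) U^-n D U^n ([Psi_conj]).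
    Everything is therefore about conjugating by powers of the unipotent U,
    and the result is polynomial in n as soon as iterated commutators with X
    die out. The hypotheses say exactly that they do:

    - the first system makes D arithmetic along the diagonal, and X is an
      eigenvector of the commutator with such a matrix:
      [D, X] = - (d a / 2) X;
    - the two products of the subdiagonal B with the superdiagonal X are
      diagonal, with entries the two terms of the second system:
      [B, X] = d J + c I;
    - hence [M, X] = C with C = d J + c I - (d a / 2) X, and [C, X] = - d X,
      because [J, X] = - X.

    Thus the commutator with X sends M to C, and both C and D to multiples of X. By [mul_pow_binomial], conjugation of M by U^x is a
    quadratic polynomial in x, and conjugation of C and D is affine in the
    exponent ([conj_pow_graded], [conj_pow_eigen]). Conjugating once more by
    U^lambda and collecting the powers of x gives the stated coefficients. In
    Psi the quadratic parts of the two summands cancel, which leaves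
    degree one. *)

(** * Conjugation by powers of a unipotent element *)

(** The binomial expansion of U^-n B U^n, written without inverses: if K and H
    are the first and second differences of n |-> U^-n B U^n at 0 and the third
    one vanishes, this sequence is B + n K + 'C(n, 2) H. *)
Lemma mul_pow_binomial (E : pzRingType) (B K H U : E) (n : nat) :
  B * U = U * (B + K) -> K * U = U * (K + H) -> H * U = U * H ->
  B * U ^+ n = U ^+ n * (B + K *+ n + H *+ 'C(n, 2)).
Proof.
move=> BU KU HU; elim: n => [|n IHn]; first by rewrite !mulr0n !addr0 mulr1 mul1r.
rewrite exprSr mulrA IHn -!mulrA; congr (_ * _).
rewrite !mulrDl !mulrnAl BU KU HU -!mulrnAr -!mulrDr; congr (_ * _).
rewrite binS bin1 mulrSr mulrnDr mulrnDl.
by rewrite [K *+ n + K]addrC -!addrA; do 3 congr (_ + _); rewrite addrC.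
Qed.

Section UnipotentConjugation.

Variables (F : numFieldType) (E : unitAlgType F) (X : E).
Hypothesis unitU : 1 + X \is a GRing.unit.

Let U := 1 + X.
Let V := U^-1.
Let S := X * V.

Lemma comm_nilpart_inv : V * X = X * V.
Proof.
have cUX : GRing.comm X U by apply: commrD; [exact: commr1 | by []].
exact/commr_sym/commrV.
Qed.

(** An eigenvector C of the commutator with X has first difference - e S, which
    commutes with U, so the expansion stops after the linear term. *)
Lemma conj_pow_eigen (C : E) (e : F) (n : nat) :
  C * X - X * C = - (e *: X) ->
  V ^+ n * C * U ^+ n = C - (n%:R * e) *: S.
Proof.
move=> /(canRL (subrK _)) CX.
have SU : S * U = X by rewrite /S -mulrA mulVr ?mulr1.
have US : U * S = X by rewrite /S -comm_nilpart_inv mulrA mulrV ?mul1r.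
rewrite -mulrA (@mul_pow_binomial _ C (- (e *: S)) 0 U n); first last.
- by rewrite mul0r mulr0.
- by rewrite addr0 mulNr mulrN -scalerAl -scalerAr SU US.
- by rewrite !mulrDr mulrN -scalerAr US mulr1 {1}/U mulrDl mul1r CX -addrA
     [- _ + _]addrC.
by rewrite exprVn mulKr ?unitrX // mul0rn addr0 mulNrn scalerMnl mulr_natl.
Qed.

(** One commutator more: the first difference of M is U^-1 C and the second one
    is - d U^-1 S, which commutes with U. *)
Lemma conj_pow_graded (M C : E) (d : F) (n : nat) :
  M * X - X * M = C -> C * X - X * C = - (d *: X) ->
  V ^+ n * M * U ^+ n = M + n%:R *: (V * C) - ('C(n, 2)%:R * d) *: (V * S).
Proof.
move=> /(canRL (subrK _)) MX CX.
have SU : S * U = X by rewrite /S -mulrA mulVr ?mulr1.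
have VK Y : U * (V * Y) = Y := mulVKr unitU Y.
have CU := conj_pow_eigen C d 1 CX.
rewrite -mulrA (@mul_pow_binomial _ M (V * C) (- (d *: (V * S))) U n).
- rewrite exprVn mulKr ?unitrX // mulNrn scaler_nat; congr (_ + _ - _).
  by rewrite scalerMnl mulr_natl.
- by rewrite [RHS]mulrDr VK {1 2}/U mulrDr mulr1 mulrDl mul1r MX -addrA [C + _]addrC.
- have -> : V * C * U = C - d *: S by rewrite -[d]mul1r -CU !expr1.
  by rewrite [RHS]mulrDr mulrN -scalerAr !VK.
- by rewrite mulNr mulrN -scalerAl -scalerAr VK -mulrA SU comm_nilpart_inv.
Qed.

(** Splitting U^(x + l) as U^x U^l keeps the dependence on x apart from that on
    l; the extra factor U on the right absorbs the U^-1 of both differences. *)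
Lemma conj_pow_quadratic (M C : E) (d : F) (l x : nat) :
  M * X - X * M = C -> C * X - X * C = - (d *: X) ->
  V ^+ (x + l) * M * U ^+ (x + l).+1
    = V ^+ l * M * U ^+ l.+1 + x%:R *: (C - (l.+1%:R * d) *: S)
      - ('C(x, 2)%:R * d) *: S.
Proof.
move=> MX CX.
have SX : S * X - X * S = - (0 *: X).
  by rewrite scale0r oppr0 /S -mulrA comm_nilpart_inv subrr.
have -> : V ^+ (x + l) * M * U ^+ (x + l).+1
          = V ^+ l * (V ^+ x * M * U ^+ x) * U ^+ l.+1.
  by rewrite -addnS (exprD U) addnC (exprD V) !mulrA.
rewrite (conj_pow_graded M C d x MX CX) mulrBr mulrBl mulrDr mulrDl.
rewrite -!scalerAr -!scalerAl ![V ^+ l * (V * _)]mulrA -exprSr.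
rewrite (conj_pow_eigen C d l.+1 CX) (conj_pow_eigen S 0 l.+1 SX).
by rewrite mulr0 scale0r subr0.
Qed.

End UnipotentConjugation.

(** * Commutators with the superdiagonal matrix A^* *)

Section SubdiagonalCommutators.

Variables (R : realType) (N : nat).
Implicit Types (mu s t f : nat -> R) (delta : nat -> nat -> R).

Lemma sum_pred_ord f (m : nat) : (m <= N)%N ->
  \sum_(k < N) (if m == k.+1 then f k else 0) = if m is p.+1 then f p else 0.
Proof.
case: m => [|p] le_pN; first by rewrite big1.
by rewrite -big_mkcond (big_pred1 (Ordinal le_pN)) // => k; rewrite eqSS eq_sym.
Qed.

Lemma sum_succ_ord f (m : nat) :
  \sum_(k < N) (if k == m :> nat then f k else 0) = if (m < N)%N then f m else 0.
Proof.
rewrite -big_mkcond; case: ltnP => [lt_mN | le_Nm].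
  by rewrite (big_pred1 (Ordinal lt_mN)).
by rewrite big1 // => k /eqP km; have:= ltn_ord k; rewrite km ltnNge le_Nm.
Qed.

Lemma invmx_diag_seq t : (forall j, (1 <= j <= N)%N -> t j != 0) ->
  diag_seq_mx N t \in unitmx
  /\ invmx (diag_seq_mx N t) = diag_seq_mx N (fun j => (t j)^-1).
Proof.
move=> t_neq0.
have VT : diag_seq_mx N t *m diag_seq_mx N (fun j => (t j)^-1) = 1%:M.
  rewrite /diag_seq_mx mulmx_diag -diag_const_mx; congr diag_mx.
  by apply/rowP=> i; rewrite !mxE mulfV // t_neq0 //=.
have [uT _] := mulmx1_unit VT; split=> //.
by rewrite -[RHS](mulKmx uT) VT mulmx1.
Qed.

(** The commutator with diag(t) multiplies the entry in position (i, j) by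
    t i - t j, and A^* has all its entries at j = i + 1. *)
Lemma comm_diag_raising mu t (e : R) :
  (forall i, (1 <= i <= N.-1)%N -> t i - t i.+1 = e) ->
  diag_seq_mx N t *m (subdiag_mx N mu)^T - (subdiag_mx N mu)^T *m diag_seq_mx N t
    = e *: (subdiag_mx N mu)^T.
Proof.
move=> t_arith; rewrite /diag_seq_mx mul_diag_mx mul_mx_diag.
apply/matrixP=> i j; rewrite !mxE; case: eqP => [ji|_]; last first.
  by rewrite !(mulr0, mul0r) subrr.
have <- : t i.+1 - t j.+1 = e.
  by rewrite ji t_arith //= -ltnS prednK -?ji // (leq_ltn_trans _ (ltn_ord j)).
by ring.
Qed.

(** A matrix supported on the first subdiagonal times one supported on the first
    superdiagonal is diagonal, in either order; the empty sums in the first and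
    last diagonal entries are the conventional zeros of [lower_term] and
    [upper_term]. *)
Lemma comm_lowering_raising mu delta (lambda : nat) :
  let B := diag_seq_mx N (fun j => (delta lambda j)^-1)
           *m subdiag_mx N mu *m diag_seq_mx N (delta lambda.+1) in
  B *m (subdiag_mx N mu)^T - (subdiag_mx N mu)^T *m B
    = diag_seq_mx N
        (fun i => lower_term mu delta lambda i - upper_term N mu delta lambda i).
Proof.
rewrite /= /diag_seq_mx mul_diag_mx mul_mx_diag.
apply/matrixP=> i j; rewrite !mxE.
under eq_bigr do rewrite !mxE.
under [X in _ - X]eq_bigr do rewrite !mxE.
have [<-{j}|ij] := eqVneq i j; last first.
  rewrite mulr0n !big1 ?subr0 // => k _.
  - case: eqP => [ki|]; last by rewrite mul0r.
    case: eqP => [kj|]; last by rewrite mulr0 mul0r mulr0.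
    by case/eqP: ij; apply: val_inj; apply: succn_inj; rewrite -ki -kj.
  - case: eqP => [ik|]; last by rewrite mulr0 !mul0r.
    case: eqP => [jk|]; last by rewrite mulr0.
    by case/eqP: ij; apply: val_inj; rewrite /= ik jk.
(* g k is the product of the entries in positions (k+1, k) and (k, k+1),
   counted from 0. *)
pose g k := (delta lambda k.+2)^-1 * (mu k.+2 / mu k.+1) * delta lambda.+1 k.+1
              * (mu k.+2 / mu k.+1).
rewrite mulr1n /lower_term /upper_term eqSS; congr (_ - _).
- rewrite (eq_bigr (fun k : 'I_N => if val i == k.+1 then g k else 0)); last first.
    by move=> k _; case: eqP => [->|_]; rewrite ?mulr0.
  rewrite sum_pred_ord ?(ltnW (ltn_ord i)) //=; case: (nat_of_ord i) => [|p] //=.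
  by rewrite /g -exprVn; ring.
- rewrite (eq_bigr (fun k : 'I_N => if k == i.+1 :> nat then g k.-1 else 0)).
    rewrite (sum_succ_ord (fun k => g k.-1)).
    have:= ltn_ord i; rewrite leq_eqVlt; case: eqP => [->|_ /= ->]; rewrite ?ltnn //.
    by rewrite /g -exprVn /=; ring.
  by move=> k _; case: eqP => [->|_]; rewrite ?mul0r //= /g mulrC.
Qed.

End SubdiagonalCommutators.

Lemma unitmx_1subdiag (R : realType) (N : nat) (mu : nat -> R) :
  1%:M + subdiag_mx N mu \in unitmx.
Proof.
rewrite unitmxE det_trig ?unitfE.
  rewrite big1 ?oner_neq0 // => i _.
  by rewrite !mxE eqxx ltn_eqF ?addr0.
apply/is_trig_mxP => i j lt_ij; rewrite !mxE -val_eqE /= (ltn_eqF lt_ij).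
by rewrite ltn_eqF ?add0r // ltnS ltnW.
Qed.

Lemma bin2_natr (R : realFieldType) (n : nat) :
  'C(n, 2)%:R = n%:R * (n%:R - 1) / 2 :> R.
Proof.
elim: n => [|n IHn]; first by rewrite !mul0r.
by rewrite binS bin1 natrD IHn -natr1; field.
Qed.

(** Polynomials in x with matrix coefficients and matrices with polynomial
    entries are the same thing. *)
Lemma matrix_poly_deg_le_sum (R : realType) (N k : nat) (C : nat -> 'M[R]_N)
    (F : nat -> 'M[R]_N) :
  (forall x, F x = \sum_(i < k.+1) x%:R ^+ i *: C i) -> matrix_poly_deg_le k F.
Proof.
move=> FE; exists (\matrix_(i, j) \poly_(m < k.+1) C m i j); split=> [i j|x].
  by rewrite mxE size_poly.
rewrite FE; apply/matrixP=> i j; rewrite !mxE horner_poly summxE.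
by apply: eq_bigr => m _; rewrite mxE mulrC.
Qed.

(** * The quotients of consecutive weights *)

Section Shift.

Variables (R : realType) (n' : nat).
Local Notation N := n'.+1.
Variables (a : R) (mu : nat -> R) (delta : nat -> nat -> R).
Hypothesis a_gt0 : 0 < a.
Hypothesis delta_gt0 : forall lambda j : nat, (1 <= j <= N)%N -> 0 < delta lambda j.
Variable lambda : nat.

Let A := subdiag_mx N mu.
Let X := A^T.
Let U := 1 + X.
Let V := U^-1.
Let T l := diag_seq_mx N (delta l).
Let D := (T lambda)^-1 * T lambda.+1.
Let M := (T lambda)^-1 * (A + 1) * T lambda.+1.

Let unitL : (1 + A) \is a GRing.unit := unitmx_1subdiag R N mu.

Let unitU : U \is a GRing.unit.
Proof.
have := unitmx_1subdiag R N mu; rewrite -unitmx_tr.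
by rewrite linearD /= trmx1.
Qed.

Let unitT l : T l \is a GRing.unit.
Proof.
by have [] := @invmx_diag_seq R N (delta l)
  (fun j Hj => lt0r_neq0 (delta_gt0 l j Hj)).
Qed.

(** Both quotients have a numerator that starts with the left factor of
    W(x); this cancels it. *)
Lemma W_quotient (Y : 'M[R]_N) (x : nat) :
  invmx (W N a mu delta lambda x%:Z)
    *m ((a ^+ x / x`!%:R) *: ((1 + A) ^+ (x + lambda) * T lambda * Y))
  = V ^+ (x + lambda) * Y.
Proof.
have s_neq0 : a ^+ x / x`!%:R \is a GRing.unit.
  by rewrite unitfE mulf_neq0 ?invr_neq0 ?expf_neq0 ?lt0r_neq0 // ltr0n fact_gt0.
have uW : W N a mu delta lambda x%:Z \in unitmx.
  by rewrite /W unitmxZ // !unitmx_mul andbC /= !unitrX ?unitT.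
rewrite -[RHS](mulKmx uW); congr (_ *m _).
rewrite /W -scalemxAl !mulmxE; congr (_ *: _).
by rewrite exprVn -[RHS]mulrA mulVKr // unitrX.
Qed.

Lemma Phi_conj x :
  Phi N a mu delta lambda x = V ^+ (x + lambda) * M * U ^+ (x + lambda).+1.
Proof.
rewrite /Phi -mulrA -W_quotient; congr (_ *m (_ *: _)).
rewrite !mulmxE addnS exprSr -!mulrA; congr (_ * _).
by rewrite /M mulVKr // [A + 1]addrC.
Qed.

(** In W^(lambda+1)(x-1) the exponent of I + A is that of W^(lambda)(x), so no
    factor I + A is left over and D takes the place of M; the ratio of the scalar
    prefactors is x / a, whose zero at x = 0 matches W(-1) = 0. *)
Lemma Psi_conj x : Psi N a mu delta lambda x
  = Phi N a mu delta lambda x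
    - (x%:R / a) *: (V ^+ (x + lambda) * D * U ^+ (x + lambda)).
Proof.
rewrite /Psi /fwd_diff subrK mulmxBr; congr (_ - _).
case: x => [|x]; first by rewrite mul0r scale0r mulmx0.
rewrite -mulrA scalerAr -W_quotient; congr (_ *m _).
have -> : x.+1%:Z - 1 = x%:Z by rewrite -[x.+1]addn1 PoszD addrK.
rewrite /W !mulmxE -!scalerAr scalerA; congr (_ *: _).
  rewrite factS exprS natrM; field.
  by rewrite lt0r_neq0 // nat1r !pnatr_eq0 -lt0n fact_gt0.
by rewrite addnS addSn /D -!mulrA mulVKr.
Qed.

Variables (d c : R).
Hypothesis first_system : forall i : nat, (1 <= i <= N.-1)%N ->
  delta lambda.+1 i / delta lambda i
    - delta lambda.+1 i.+1 / delta lambda i.+1 = - (d * a / 2).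
Hypothesis second_system : forall i : nat, (1 <= i <= N)%N ->
  lower_term mu delta lambda i - upper_term N mu delta lambda i = d * i%:R + c.

Let J := J_mx R N.
Let C := d *: J + c *: 1 - (d * a / 2) *: X.
Let S := X * V.

Lemma invT : (T lambda)^-1 = diag_seq_mx N (fun j => (delta lambda j)^-1).
Proof.
by have [] := @invmx_diag_seq R N (delta lambda)
  (fun j Hj => lt0r_neq0 (delta_gt0 lambda j Hj)).
Qed.

Lemma comm_diag_part : D * X - X * D = - (d * a / 2) *: X.
Proof.
rewrite -(comm_diag_raising _ _ mu _ _ first_system).
suff -> : D = diag_seq_mx N (fun i => delta lambda.+1 i / delta lambda i) by [].
rewrite /D invT -mulmxE /diag_seq_mx mulmx_diag; congr diag_mx.
by apply/rowP=> i; rewrite !mxE mulrC.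
Qed.

Lemma diag_affineE : diag_seq_mx N (fun i => d * i%:R + c) = d *: J + c *: 1.
Proof.
by apply/matrixP=> i j; rewrite !mxE; case: eqP => _; rewrite ?mulr1n; ring.
Qed.

(** The two systems enter here together: the second one through the part of M
    below the diagonal, the first one through its diagonal part D. *)
Lemma comm_middle : M * X - X * M = C.
Proof.
have -> : M = (T lambda)^-1 * A * T lambda.+1 + D by rewrite /M mulrDr mulr1 mulrDl.
rewrite mulrDl mulrDr opprD addrACA comm_diag_part invT scaleNr; congr (_ - _).
rewrite -diag_affineE -!mulmxE comm_lowering_raising.
by congr diag_mx; apply/rowP=> i; rewrite !mxE second_system //=.
Qed.

(** The term of C in X commutes with X, so only the arithmetic diagonal
    d J + c I contributes, with common difference d. *)
Lemma comm_second : C * X - X * C = - (d *: X).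
Proof.
have H (i : nat) : (1 <= i <= N.-1)%N ->
    (d * i%:R + c) - (d * i.+1%:R + c) = - d.
  by move=> _; rewrite -natr1; ring.
have := comm_diag_raising _ _ mu _ _ H; rewrite diag_affineE -/X scaleNr => <-.
by rewrite /C mulrBl mulrBr -scalerAl -scalerAr !mulmxE opprB addrA subrK.
Qed.

Lemma Phi_formula x : Phi N a mu delta lambda x
  = x%:R ^+ 2 *: K2_mx N mu d + x%:R *: K1_mx N a mu lambda d c
    + K0_mx N mu delta lambda.
Proof.
rewrite Phi_conj
  (conj_pow_quadratic _ _ _ unitU M C d lambda x comm_middle comm_second).
have -> : K0_mx N mu delta lambda = V ^+ lambda * M * U ^+ lambda.+1.
  by rewrite /K0_mx !mulmxE [_^T + _]addrC /M !mulrA.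
have -> : K1_mx N a mu lambda d c
    = (d / 2) *: (2 *: J - a *: X - (2 * lambda + 1)%:R *: S) + c *: 1.
  by rewrite /K1_mx !mulmxE [_^T + _]addrC.
have -> : K2_mx N mu d = - (d / 2) *: S.
  by rewrite /K2_mx !mulmxE [_^T + _]addrC.
rewrite bin2_natr natrD natrM -[lambda.+1%:R]natr1 /C -/U -/V -/S.
(* Only a linear identity between fixed matrices is left; entry by entry it is
   an identity in the field. *)
move: (V ^+ lambda * M * _) S X J (1 : 'M[R]_N) => k0 s y j i1.
apply/matrixP=> p q; rewrite !mxE; by field.
Qed.

(** Raising the exponent lambda of the conjugated D to lambda + 1, as in
    [J1_mx], subtracts (d a / 2) S; after division by - a this cancels the
    summand [K2_mx] there. *)
Lemma Psi_formula x : Psi N a mu delta lambda x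
  = x%:R *: J1_mx N a mu delta lambda d c + J0_mx N mu delta lambda.
Proof.
have CX : D * X - X * D = - ((d * a / 2) *: X) by rewrite comm_diag_part scaleNr.
rewrite Psi_conj Phi_formula (conj_pow_eigen _ _ _ unitU D _ _ CX).
have -> : J1_mx N a mu delta lambda d c = K2_mx N mu d + K1_mx N a mu lambda d c
    - a^-1 *: (V ^+ lambda.+1 * D * U ^+ lambda.+1).
  by rewrite /J1_mx !mulmxE [_^T + _]addrC /D !mulrA.
rewrite (conj_pow_eigen _ _ _ unitU D _ _ CX) /J0_mx.
have -> : K2_mx N mu d = - (d / 2) *: S.
  by rewrite /K2_mx !mulmxE [_^T + _]addrC.
rewrite -/U -/V -/S.
move: (K1_mx _ _ _ _ _ _) (K0_mx _ _ _ _) D S => k1 k0 D' s.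
rewrite natrD -[lambda.+1%:R]natr1.
apply/matrixP=> p q; rewrite !mxE; field.
exact: lt0r_neq0.
Qed.

End Shift.

(** * The theorem *)

Theorem theorem6p2 (R : realType) (N : nat) (a : R) (mu : nat -> R)
    (delta : nat -> nat -> R)
    (N_ge1 : (1 <= N)%N) (a_gt0 : 0 < a)
    (mu_gt0 : forall j : nat, (1 <= j <= N)%N -> 0 < mu j)
    (delta_gt0 : forall lambda j : nat, (1 <= j <= N)%N -> 0 < delta lambda j)
    (lambda : nat) (d c : R) (d_neq0 : d != 0)
    (first_system : forall i : nat, (1 <= i <= N.-1)%N ->
       delta lambda.+1 i / delta lambda i
         - delta lambda.+1 i.+1 / delta lambda i.+1 = - (d * a / 2))
    (second_system : forall i : nat, (1 <= i <= N)%N ->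
       lower_term mu delta lambda i - upper_term N mu delta lambda i
         = d * i%:R + c) :
  [/\ matrix_poly_deg_le 2 (Phi N a mu delta lambda),
      matrix_poly_deg_le 1 (Psi N a mu delta lambda),
      (forall x : nat, Phi N a mu delta lambda x =
         x%:R ^+ 2 *: K2_mx N mu d + x%:R *: K1_mx N a mu lambda d c
         + K0_mx N mu delta lambda)
    & (forall x : nat, Psi N a mu delta lambda x =
         x%:R *: J1_mx N a mu delta lambda d c + J0_mx N mu delta lambda)].
Proof.
case: N N_ge1 mu_gt0 delta_gt0 first_system second_system => [//|n].
move=> _ _ delta_gt0' sys1 sys2.
have PhiE := Phi_formula R n a mu delta a_gt0 delta_gt0' lambda d c sys1 sys2.
have PsiE := Psi_formula R n a mu delta a_gt0 delta_gt0' lambda d c sys1 sys2.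
split=> //.
- apply: (matrix_poly_deg_le_sum _ _ _ (nth 0
    [:: K0_mx n.+1 mu delta lambda; K1_mx n.+1 a mu lambda d c;
        K2_mx n.+1 mu d])) => x.
  by rewrite PhiE !big_ord_recl big_ord0 /= expr0 scale1r addr0 expr1
    [RHS]addrC [_ + x%:R *: _]addrC.
- apply: (matrix_poly_deg_le_sum _ _ _ (nth 0
    [:: J0_mx n.+1 mu delta lambda; J1_mx n.+1 a mu delta lambda d c])) => x.
  by rewrite PsiE !big_ord_recl big_ord0 /= expr0 scale1r addr0 expr1 addrC.
Qed.
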